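(* Let $X$ be a locally compact Hausdorff space with a Borel measure $\mu$ such that $0<\mu(X)<\infty$ and such that the only class $[f]\in\mathbb{TP}(X)$ with $f$ $\mu$-a.e. equal to a constant is the class of constants. If $S$ is a compact subset of $\mathbb{TP}(X)$, then the closed tropical convex hulls $\underline{\mathrm{TCONV}}(S)$, $\overline{\mathrm{TCONV}}(S)$ and $\underline{\overline{\mathrm{TCONV}}}(S)$ are all compact.
   Context: $BC(X)$: bounded continuous real functions on $X$; $\mathbb{TP}(X)=BC(X)/(\text{constants})$, $[f]$ the class of $f$, with metric $\rho([f],[g])=\sup(g-f)-\inf(g-f)$ and its topology. $\underline{f}=f-\inf f$, $\overline{f}=f-\sup f$. For $\alpha=[f],\beta=[g]$, $d=\rho(\alpha,\beta)$: lower tropical segment $\{[\min(t,\underline{g-f})+f]:t\in[0,d]\}$, upper tropical segment $\{[\max(-t,\overline{g-f})+f]:t\in[0,d]\}$. Lower (upper) tropically convex sets contain the lower (upper) segment between any two of their points; $\underline{\mathrm{tconv}}(S)$ ($\overline{\mathrm{tconv}}(S)$) is the intersection of all lower (upper) tropically convex sets containing $S$. $\underline{\mathrm{TCONV}}(S)$ (resp. $\overline{\mathrm{TCONV}}(S)$) is the intersection of all closed lower (resp. upper) tropically convex subsets of $\mathbb{TP}(X)$ containing $S$, and $\underline{\overline{\mathrm{TCONV}}}(S)$ is the closure of $\underline{\mathrm{tconv}}(\overline{\mathrm{tconv}}(S))$. *)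

(* Defs.v *)
From HB Require Import structures.
From mathcomp Require Import all_boot all_order all_algebra.
From mathcomp Require Import generic_quotient.
From mathcomp Require Import all_classical all_reals all_analysis.

Set Implicit Arguments.
Unset Strict Implicit.
Unset Printing Implicit Defensive.

Import Order.TTheory GRing.Theory Num.Theory.
Import numFieldNormedType.Exports.

Local Open Scope classical_set_scope.
Local Open Scope ring_scope.
Local Open Scope quotient_scope.

(* [X] is pointed because the measurable types of the library are; a space
   of positive measure is nonempty, so this costs no generality. *)

Section BoundedContinuous.
Variables (X : ptopologicalType) (R : realType).

Definition bc_pred : {pred X -> R} :=
  [pred f | `[< continuous f /\ bounded_fun f >]].

Record BC := MkBC { bc_fun :> X -> R; _ : bc_fun \in bc_pred }.

HB.instance Definition _ := [isSub for bc_fun].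
HB.instance Definition _ := [Choice of BC by <:].

Lemma bc_predP (f : X -> R) :
  reflect (continuous f /\ bounded_fun f) (f \in bc_pred).
Proof. by rewrite inE; exact: asboolP. Qed.

Lemma bc_zmod_closed : zmod_closed bc_pred.
Proof.
split.
  apply/bc_predP; split; first by move=> x; exact: cvg_cst.
  exists 0; split; first exact: real0.
  by move=> M M0 x _ /=; rewrite normr0 ltW.
move=> f g /bc_predP[cf bf] /bc_predP[cg bg]; apply/bc_predP; split.
  by move=> x; exact: (cvgB (cf x) (cg x)).
exact: (bounded_funD bf (bounded_funN bg)).
Qed.

HB.instance Definition _ := GRing.isZmodClosed.Build _ bc_pred bc_zmod_closed.
HB.instance Definition _ := [SubChoice_isSubZmodule of BC by <:].

Implicit Types f g : BC.

Lemma bc_continuous f : continuous f.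
Proof. by case: f => f /= /bc_predP[]. Qed.

Lemma bc_bounded f : bounded_fun f.
Proof. by case: f => f /= /bc_predP[]. Qed.

Lemma bc_eqP f g : f =1 g -> f = g.
Proof. by move=> fg; apply/val_inj/funext. Qed.

Lemma bcB f g x : (f - g) x = f x - g x. Proof. by []. Qed.
Lemma bcD f g x : (f + g) x = f x + g x. Proof. by []. Qed.

Lemma bc_cst_subproof (c : R) : cst c \in bc_pred.
Proof.
apply/bc_predP; split; first by move=> x; exact: cvg_cst.
exists `|c|; split; first exact: num_real.
by move=> M cM x _ /=; exact: ltW.
Qed.
Definition bc_cst c := MkBC (bc_cst_subproof c).

Lemma bc_min_subproof f g : (fun x => Num.min (f x) (g x)) \in bc_pred.
Proof.
apply/bc_predP; split.
  by move=> x; exact: (continuous_min (@bc_continuous f x) (@bc_continuous g x)).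
have [A [rA fA]] := bc_bounded f; have [B [rB gB]] := bc_bounded g.
exists (Num.max A B); split; first exact: num_real.
move=> M; rewrite gt_max => /andP[AM BM] x _ /=.
by case: (leP (f x) (g x)) => _; [exact: fA|exact: gB].
Qed.
Definition bc_min f g := MkBC (bc_min_subproof f g).

Lemma bc_max_subproof f g : (fun x => Num.max (f x) (g x)) \in bc_pred.
Proof.
apply/bc_predP; split.
  by move=> x; exact: (continuous_max (@bc_continuous f x) (@bc_continuous g x)).
have [A [rA fA]] := bc_bounded f; have [B [rB gB]] := bc_bounded g.
exists (Num.max A B); split; first exact: num_real.
move=> M; rewrite gt_max => /andP[AM BM] x _ /=.
by case: (leP (f x) (g x)) => _; [exact: gB|exact: fA].
Qed.
Definition bc_max f g := MkBC (bc_max_subproof f g).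

Definition bc_sup f : R := sup (range f).
Definition bc_inf f : R := inf (range f).

Definition bc_under f : BC := f - bc_cst (bc_inf f).
Definition bc_over f : BC := f - bc_cst (bc_sup f).

Definition bc_rho f g : R := bc_sup (g - f) - bc_inf (g - f).

Lemma bc_has_sup f : has_sup (range f).
Proof.
split; first by exists (f point), point.
exact: (bounded_fun_has_ubound (@bc_bounded f)).
Qed.

Lemma bc_has_inf f : has_inf (range f).
Proof.
split; first by exists (f point), point.
exact: (bounded_fun_has_lbound (@bc_bounded f)).
Qed.

Lemma bc_sup_ge f x : f x <= bc_sup f.
Proof. by apply: sup_upper_bound (bc_has_sup f) _ _; exists x. Qed.

Lemma bc_inf_le f x : bc_inf f <= f x.
Proof. by apply: (ge_inf (bc_has_inf f).2); exists x. Qed.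

Lemma bc_sup_le f c : (forall x, f x <= c) -> bc_sup f <= c.
Proof.
move=> fc; apply: ge_sup; first by exists (f point), point.
by move=> _ [x _ <-].
Qed.

Lemma bc_inf_ge f c : (forall x, c <= f x) -> c <= bc_inf f.
Proof.
move=> fc; apply: lb_le_inf; first by exists (f point), point.
by move=> _ [x _ <-].
Qed.

Lemma bc_supN f : bc_sup (- f) = - bc_inf f.
Proof.
apply/eqP; rewrite eq_le; apply/andP; split.
  by apply: bc_sup_le => x; rewrite lerN2 bc_inf_le.
rewrite lerNl; apply: bc_inf_ge => x.
by rewrite lerNl; exact: (bc_sup_ge (- f)).
Qed.

Lemma bc_infN f : bc_inf (- f) = - bc_sup f.
Proof. by rewrite -[in RHS](opprK f) bc_supN opprK. Qed.

Lemma bc_supDc f c : bc_sup (f + bc_cst c) = bc_sup f + c.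
Proof.
apply/eqP; rewrite eq_le; apply/andP; split.
  by apply: bc_sup_le => x; rewrite bcD lerD2r bc_sup_ge.
rewrite -lerBrDr; apply: bc_sup_le => x; rewrite lerBrDr.
exact: (bc_sup_ge (f + bc_cst c)).
Qed.

Lemma bc_infDc f c : bc_inf (f + bc_cst c) = bc_inf f + c.
Proof.
apply/eqP; rewrite eq_le; apply/andP; split; last first.
  by apply: bc_inf_ge => x; rewrite bcD lerD2r bc_inf_le.
rewrite -lerBlDr; apply: bc_inf_ge => x; rewrite lerBlDr.
exact: (bc_inf_le (f + bc_cst c)).
Qed.

Lemma bc_cstD c d : bc_cst (c + d) = bc_cst c + bc_cst d.
Proof. exact: bc_eqP. Qed.

Lemma bc_cstN c : bc_cst (- c) = - bc_cst c.
Proof. exact: bc_eqP. Qed.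

Lemma bc_underDc f c : bc_under (f + bc_cst c) = bc_under f.
Proof. by rewrite /bc_under bc_infDc bc_cstD opprD addrACA subrr addr0. Qed.

Lemma bc_overDc f c : bc_over (f + bc_cst c) = bc_over f.
Proof. by rewrite /bc_over bc_supDc bc_cstD opprD addrACA subrr addr0. Qed.

Definition tp_equiv f g := `[< exists c : R, f - g = bc_cst c >].

Lemma tp_equiv_refl : reflexive tp_equiv.
Proof. by move=> f; apply/asboolP; exists 0; rewrite subrr; exact: bc_eqP. Qed.

Lemma tp_equiv_sym : symmetric tp_equiv.
Proof.
have H f g : tp_equiv f g -> tp_equiv g f.
  move=> /asboolP[c fg]; apply/asboolP; exists (- c).
  by rewrite bc_cstN -fg opprB.
by move=> f g; apply/idP/idP; exact: H.
Qed.

Lemma tp_equiv_trans : transitive tp_equiv.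
Proof.
move=> g f h /asboolP[c fg] /asboolP[d gh]; apply/asboolP; exists (c + d).
by rewrite bc_cstD -fg -gh addrA subrK.
Qed.

Canonical tp_equiv_rel :=
  EquivRel tp_equiv tp_equiv_refl tp_equiv_sym tp_equiv_trans.

Definition TP : Type := {eq_quot tp_equiv_rel}.
HB.instance Definition _ := Choice.on TP.
HB.instance Definition _ := Quotient.on TP.

Definition tp_class f : TP := \pi_TP f.

Lemma tp_classP f g : tp_class f = tp_class g <-> exists c, f = g + bc_cst c.
Proof.
split.
  move=> fg; have /asboolP[c e] : tp_equiv f g.
    exact/eqmodP.
  by exists c; rewrite -e addrC subrK.
move=> [c ->]; apply/eqmodP/asboolP.
by exists c; rewrite addrC addKr.
Qed.

Lemma tp_class_repr (a : TP) : tp_class (repr a) = a.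
Proof. exact: reprK. Qed.

Lemma tp_repr_class f : exists c, repr (tp_class f) = f + bc_cst c.
Proof. by apply/tp_classP; rewrite tp_class_repr. Qed.

Definition tp_rho (a b : TP) : R := bc_rho (repr a) (repr b).

Lemma bc_subDc f g c d :
  (g + bc_cst d) - (f + bc_cst c) = (g - f) + bc_cst (d - c).
Proof. by rewrite bc_cstD bc_cstN opprD addrACA. Qed.

Lemma tp_rhoE f g : tp_rho (tp_class f) (tp_class g) = bc_rho f g.
Proof.
rewrite /tp_rho; have [c ->] := tp_repr_class f.
have [d ->] := tp_repr_class g.
by rewrite /bc_rho bc_subDc bc_supDc bc_infDc opprD addrACA subrr addr0.
Qed.

Lemma tp_rhoxx a : tp_rho a a = 0.
Proof.
rewrite /tp_rho /bc_rho subrr; apply/eqP; rewrite subr_eq0; apply/eqP/le_anti.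
by rewrite (le_trans (bc_inf_le 0 point) (bc_sup_ge 0 point)) andbT
  (le_trans (bc_sup_le (c := 0) _) (bc_inf_ge (c := 0) _)).
Qed.

Lemma tp_rho_positivity a b : tp_rho a b = 0 -> a = b.
Proof.
rewrite -(tp_class_repr a) -(tp_class_repr b) tp_rhoE.
move: (repr a) (repr b) => f g /eqP; rewrite subr_eq0 => /eqP e.
apply/esym/tp_classP; exists (bc_sup (g - f)); apply: bc_eqP => x.
rewrite bcD /= -[LHS](subrK (f x)) addrC; congr (_ + _).
by apply: le_anti; rewrite (bc_sup_ge (g - f)) e (bc_inf_le (g - f)).
Qed.

Lemma tp_rho_sym a b : tp_rho a b = tp_rho b a.
Proof.
rewrite /tp_rho /bc_rho -(opprB (repr a)) bc_supN
  [bc_inf (- _)]bc_infN.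
by rewrite [- - bc_sup _]opprK addrC.
Qed.

Lemma tp_rho_triangle b a c : tp_rho a c <= tp_rho a b + tp_rho b c.
Proof.
rewrite /tp_rho; move: (repr a) (repr b) (repr c) => f g h.
rewrite /bc_rho addrACA -opprD; apply: lerB.
  apply: bc_sup_le => x; rewrite bcB -(subrK (g x) (h x)) -addrA addrC.
  by apply: lerD; [exact: (bc_sup_ge (g - f))|exact: (bc_sup_ge (h - g))].
apply: bc_inf_ge => x; rewrite bcB -(subrK (g x) (h x)) -addrA addrC.
by apply: lerD; [exact: (bc_inf_le (g - f))|exact: (bc_inf_le (h - g))].
Qed.

HB.instance Definition _ := @isMetric.Build R TP
  tp_rho tp_rhoxx tp_rho_positivity tp_rho_sym tp_rho_triangle.

End BoundedContinuous.

Section TropicalConvexity.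
Variables (X : ptopologicalType) (R : realType).
Local Notation BC := (BC X R).
Local Notation TP := (TP X R).
Implicit Types (f g : BC) (a b : TP) (S : set TP).

Definition bc_lower f g (t : R) : BC :=
  bc_min (bc_cst X t) (bc_under (g - f)) + f.
Definition bc_upper f g (t : R) : BC :=
  bc_max (bc_cst X (- t)) (bc_over (g - f)) + f.

(* The segments are computed with chosen representatives; [lower_segmentE]
   and [upper_segmentE] show that the choice does not matter. *)
Definition lower_segment a b : set TP :=
  [set tp_class (bc_lower (repr a) (repr b) t) | t in `[0, mdist a b]].
Definition upper_segment a b : set TP :=
  [set tp_class (bc_upper (repr a) (repr b) t) | t in `[0, mdist a b]].

Lemma lower_segmentE f g :
  lower_segment (tp_class f) (tp_class g) =
  [set tp_class (bc_lower f g t) | t in `[0, bc_rho f g]].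
Proof.
rewrite /lower_segment [mdist _ _]tp_rhoE; apply: eq_imagel => t _.
have [c ->] := tp_repr_class f; have [d ->] := tp_repr_class g.
apply/tp_classP; exists c.
by rewrite /bc_lower bc_subDc bc_underDc addrA.
Qed.

Lemma upper_segmentE f g :
  upper_segment (tp_class f) (tp_class g) =
  [set tp_class (bc_upper f g t) | t in `[0, bc_rho f g]].
Proof.
rewrite /upper_segment [mdist _ _]tp_rhoE; apply: eq_imagel => t _.
have [c ->] := tp_repr_class f; have [d ->] := tp_repr_class g.
apply/tp_classP; exists c.
by rewrite /bc_upper bc_subDc bc_overDc addrA.
Qed.

Definition lower_convex S :=
  forall a b, S a -> S b -> lower_segment a b `<=` S.
Definition upper_convex S :=
  forall a b, S a -> S b -> upper_segment a b `<=` S.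

Definition lower_tconv S : set TP := smallest lower_convex S.
Definition upper_tconv S : set TP := smallest upper_convex S.

Definition lower_TCONV S : set TP :=
  smallest [set C | closed C /\ lower_convex C] S.
Definition upper_TCONV S : set TP :=
  smallest [set C | closed C /\ upper_convex C] S.
Definition lower_upper_TCONV S : set TP :=
  closure (lower_tconv (upper_tconv S)).

End TropicalConvexity.

(* Main.v *)
(* Let D x y be the supremum over [f] in S of |f x - f y|. The classes of
   functions that are 1-Lipschitz for the pseudometric D contain S and are stable
   under min and max up to constants, so they form a set that is convex in both
   senses. Since S is compact, D is continuous and (X, D) is totally bounded, and
   Arzela-Ascoli makes this set compact. The three hulls are closed subsets of it. *)
Require Import Defs.
From HB Require Import structures.
From mathcomp Require Import all_boot all_order all_algebra.
From mathcomp Require Import all_classical all_reals all_analysis.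
From mathcomp Require Import finmap lra.

Import Order.TTheory GRing.Theory Num.Theory.
Import numFieldNormedType.Exports.

Local Open Scope classical_set_scope.
Local Open Scope ring_scope.

(** * Ultrafilter limits and elementary estimates *)

Lemma ultra_cvg_bounded {R : realType} {T : Type} (F : set_system T)
    (p : T -> R) (M : R) :
  UltraFilter F -> (\forall t \near F, `|p t| <= M) ->
  exists l : R, p @ F --> l.
Proof.
move=> FU pM.
have [|l [_ lcl]] := @segment_compact R (- M) M (p @ F) _.
  by apply: filterS pM => t /=; rewrite in_itv /= ler_norml.
exists l => A lA.
(* An ultrafilter converges to its cluster points: otherwise the preimage of the complement of [A]
   would be in [F], although [l] clusters [p @ F]. *)
have [//|FA] := in_ultra_setVsetC (p @^-1` A) FU.
by have [x []] := lcl (~` A) A FA lA.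
Qed.

Lemma ler_dist_min {R : realType} (M p q p' q' : R) :
  `|p - p'| <= M -> `|q - q'| <= M ->
  `|Num.min p q - Num.min p' q'| <= M.
Proof.
rewrite !ler_norml => /andP[? ?] /andP[? ?].
by case: (leP p q) => ?; case: (leP p' q') => ?; lra.
Qed.

Lemma ler_dist_max {R : realType} (M p q p' q' : R) :
  `|p - p'| <= M -> `|q - q'| <= M ->
  `|Num.max p q - Num.max p' q'| <= M.
Proof.
rewrite !ler_norml => /andP[? ?] /andP[? ?].
by case: (leP p q) => ?; case: (leP p' q') => ?; lra.
Qed.

Lemma finite_int_segment (N : nat) :
  finite_set [set z : int | - N%:Z <= z <= N%:Z].
Proof.
apply: (@sub_finite_set _ _ ((fun n : nat => n%:Z - N%:Z) @` `I_(N + N).+1)).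
  move=> z /= /andP[z1 z2].
  have z0 : 0 <= z + N%:Z by rewrite -lerBlDr sub0r.
  exists (absz (z + N%:Z)); last by rewrite gez0_abs// addrK.
  by rewrite /= ltnS -lez_nat gez0_abs// PoszD lerD2r.
exact: finite_image.
Qed.

(** * Value differences as coordinates on [TP X R] *)

Section Oscillation.
Context {R : realType} {X : ptopologicalType}.
Implicit Types (f g : BC X R) (a b : TP X R) (S : set (TP X R)) (x y : X).

(* [compact_cover] is stated for pointed spaces. *)
HB.instance Definition _ := isPointed.Build (TP X R) (tp_class (bc_cst X 0)).

(** A class has no values, but differences of values do not depend on the representative. *)
Definition tp_diff a x y : R := repr a x - repr a y.

Lemma tp_diff_class f x y : tp_diff (tp_class f) x y = f x - f y.
Proof.
by rewrite /tp_diff; have [c ->] := tp_repr_class f; rewrite !bcD /=; lra.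
Qed.

(** Together with [mdist_le], this makes [mdist a b] the supremum of these distances over [x] and
    [y]. *)
Lemma tp_diff_le_mdist a b x y :
  `|tp_diff a x y - tp_diff b x y| <= mdist a b.
Proof.
rewrite /tp_diff [mdist _ _]/(bc_rho _ _) /bc_rho.
move: (repr a) (repr b) => f g.
have := bc_sup_ge (g - f) x; have := bc_sup_ge (g - f) y.
have := bc_inf_le (g - f) x; have := bc_inf_le (g - f) y.
by rewrite !bcB ler_norml; lra.
Qed.

Lemma mdist_le a b (e : R) :
  (forall x y, `|tp_diff a x y - tp_diff b x y| <= e) -> mdist a b <= e.
Proof.
rewrite /tp_diff [mdist _ _]/(bc_rho _ _) /bc_rho.
move: (repr a) (repr b) => f g fg.
rewrite lerBlDr; apply: bc_sup_le => x; rewrite -lerBlDl.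
apply: bc_inf_ge => y; have := fg x y.
by rewrite !bcB ler_norml; lra.
Qed.

Lemma tp_diff_bounded a : exists M, forall x y, `|tp_diff a x y| <= M.
Proof.
exists (bc_sup (repr a) - bc_inf (repr a)) => x y; rewrite /tp_diff.
have := bc_sup_ge (repr a) x; have := bc_sup_ge (repr a) y.
have := bc_inf_le (repr a) x; have := bc_inf_le (repr a) y.
by rewrite ler_norml; lra.
Qed.

Lemma tp_diff_near a x (e : R) :
  0 < e -> \forall y \near x, `|tp_diff a x y| <= e.
Proof.
move=> e0; have /cvgrPdist_le := @bc_continuous X R (repr a) x.
by move=> /(_ e e0).
Qed.

(** * Finite nets *)

Lemma finite_tp_net (L : {fset TP X R}) (e : R) : 0 < e ->
  exists A : {fset X}, forall x, exists2 y, y \in A &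
    forall b, b \in L -> `|tp_diff b x y| <= e.
Proof.
move=> e0.
(* Pigeonhole: the integer parts of [repr b x / e] for [b] in [L] form finitely many codes, and
   equal codes force values within [e] of each other. The net takes one point per code. *)
pose code (s : seq (TP X R)) x := [seq Num.floor (repr b x / e) | b <- s].
have code_fin s : finite_set (range (code s)).
  elim: s => [|b s IH].
    by apply: (@sub_finite_set _ _ [set [::]]) => // _ [x _ <-].
  have [c cb] : exists c : nat, forall x, `|repr b x / e| <= c%:R.
    have [M [_ bM]] := bc_bounded (repr b).
    (* [M] only provides bounds by reals strictly above it, hence [|M| + 1]. *)
    exists (Num.truncn ((`|M| + 1) / e)).+1 => x.
    apply: le_trans (ltW (truncnS_gt _)).
    rewrite normrM normfV (gtr0_norm e0) ler_pM2r ?invr_gt0//.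
    by apply: (bM (`|M| + 1)) => //; have := ler_norm M; lra.
  have hfin := finite_int_segment c.+1.
  apply: sub_finite_set (finite_image2 cons hfin IH).
  move=> _ [x _ <-]; exists (Num.floor (repr b x / e)) => /=; last first.
    by exists (code s x) => //; exists x.
  have := cb x; rewrite ler_norml => /andP[c1 c2]; apply/andP; split.
    rewrite floor_ge_int; apply: le_trans c1.
    by rewrite rmorphN /= lerN2 -pmulrn ler_nat.
  rewrite -(ler_int R); apply: le_trans (floor_le _) _.
  by apply: (le_trans c2); rewrite -pmulrn ler_nat.
have /finite_fsetP[A eA] : finite_set
    ((fun v => xget point [set x | code L x = v]) @` range (code L)).
  exact: finite_image.
exists A => x; exists (xget point [set z | code L z = code L x]).
  have : [set` A] (xget point [set z | code L z = code L x]).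
    by rewrite -eA; exists (code L x) => //; exists x.
  by [].
have : code L (xget point [set z | code L z = code L x]) = code L x.
  by apply: (xgetPex point (P := [set z | code L z = code L x])); exists x.
move: (xget _ _) => y /eq_in_map exy b bL.
have {exy} := exy b bL.
have /andP[] := floor_itv (repr b x / e).
have /andP[] := floor_itv (repr b y / e).
move=> y1 y2 x1 x2 exy; rewrite exy in y1 y2.
rewrite /tp_diff.
have -> : repr b x - repr b y = (repr b x / e - repr b y / e) * e.
  by rewrite mulrBl !divfK// gt_eqF.
rewrite normrM (gtr0_norm e0) ler_piMl ?(ltW e0)//.
by move: x2 y2; rewrite intrD ler_norml; lra.
Qed.

Lemma compact_tp_net S (e : R) : 0 < e -> compact S ->
  exists L : {fset TP X R}, forall a, S a -> exists2 b, b \in L &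
    forall x y, `|tp_diff a x y - tp_diff b x y| <= e.
Proof.
move=> e0; rewrite compact_cover.
move=> /(_ _ S (fun b => (ball b e)°)) [||L LS SL].
- by move=> b _; exact: open_interior.
- by move=> b Sb; exists b => //; exact: nbhsx_ballx.
exists L => a /SL[b /= bL] /interior_subset.
rewrite ballEmdist /= => ab; exists b => // x y.
by rewrite distrC (le_trans (tp_diff_le_mdist b a x y)) ?ltW.
Qed.

(** * The dominated classes and their convexity *)

(* The D-Lipschitz classes, with D replaced by its upper bounds M. *)
Definition osc_dominated S : set (TP X R) := [set b | forall x y M,
  (forall a, S a -> `|tp_diff a x y| <= M) -> `|tp_diff b x y| <= M].

Lemma osc_dominated_sub S : S `<=` osc_dominated S.
Proof. by move=> a Sa x y M; apply. Qed.

Lemma lower_convex_osc_dominated S : lower_convex (osc_dominated S).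
Proof.
move=> a b Sa Sb _ [t _ <-] x y M SM; rewrite tp_diff_class.
have E z : bc_lower (repr a) (repr b) t z = Num.min t
    (repr b z - repr a z - bc_inf (repr b - repr a)) + repr a z by [].
(* With [repr a] moved inside, this is the minimum of a representative of [a] and one of [b], and
   [Num.min] is nonexpansive for the maximum norm. *)
rewrite !E (addr_minl t) (addr_minl t); apply: ler_dist_min.
  by have := Sa x y M SM; rewrite /tp_diff !ler_norml; lra.
by have := Sb x y M SM; rewrite /tp_diff !ler_norml; lra.
Qed.

Lemma upper_convex_osc_dominated S : upper_convex (osc_dominated S).
Proof.
move=> a b Sa Sb _ [t _ <-] x y M SM; rewrite tp_diff_class.
have E z : bc_upper (repr a) (repr b) t z = Num.max (- t)
    (repr b z - repr a z - bc_sup (repr b - repr a)) + repr a z by [].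
rewrite !E (addr_maxl (- t)) (addr_maxl (- t)); apply: ler_dist_max.
  by have := Sa x y M SM; rewrite /tp_diff !ler_norml; lra.
by have := Sb x y M SM; rewrite /tp_diff !ler_norml; lra.
Qed.

(** * Uniform estimates over a compact [S] *)

Lemma compact_tp_bounded S : compact S ->
  exists M, forall a x y, S a -> `|tp_diff a x y| <= M.
Proof.
move=> /(compact_tp_net S 1 ltr01)[L SL].
pose B b := xget 0 [set M | forall x y, `|tp_diff b x y| <= M].
have BP b x y : `|tp_diff b x y| <= B b.
  by apply: (xgetPex 0 (tp_diff_bounded b)).
have B0 b : 0 <= B b by apply: le_trans (BP b point point).
(* The sum dominates each bound, all being nonnegative; the 1 is the radius of the net. *)
exists (\sum_(b <- L) B b + 1) => a x y /SL[b bL ab].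
have : B b <= \sum_(b <- L) B b.
  by rewrite (big_fsetD1 b)//= lerDl sumr_ge0.
have := BP b x y; have := ab x y.
by rewrite !ler_norml; lra.
Qed.

(** Equicontinuity, that is, continuity of D: the finitely many members of an [e / 2]-net of [S] are
    continuous, and passing to the net costs the other [e / 2]. *)
Lemma compact_tp_near S x (e : R) : compact S -> 0 < e ->
  \forall y \near x, forall a, S a -> `|tp_diff a x y| <= e.
Proof.
move=> Sc e0; have e20 : 0 < e / 2 by rewrite divr_gt0.
have [L SL] := compact_tp_net S (e / 2) e20 Sc.
have : \forall y \near x,
    (\bigcap_(b in [set` L]) [set y | `|tp_diff b x y| <= e / 2]) y.
  by apply: filter_bigI => b _; exact: tp_diff_near.
apply: filterS => y Ly a /SL[b bL ab].
by have := Ly b bL; have := ab x y; rewrite /= !ler_norml; lra.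
Qed.

(** Total boundedness of (X, D), by the same splitting of [e]. *)
Lemma compact_tp_base_net S (e : R) : compact S -> 0 < e ->
  exists A : {fset X}, forall x, exists2 y, y \in A &
    forall a, S a -> `|tp_diff a x y| <= e.
Proof.
move=> Sc e0; have e20 : 0 < e / 2 by rewrite divr_gt0.
have [L SL] := compact_tp_net S (e / 2) e20 Sc.
have [A LA] := finite_tp_net L (e / 2) e20.
exists A => x; have [y yA Ly] := LA x; exists y => // a /SL[b bL ab].
by have := Ly b bL; have := ab x y; rewrite !ler_norml; lra.
Qed.

(** * Arzela-Ascoli along an ultrafilter *)

Lemma compact_osc_dominated S : compact S -> compact (osc_dominated S).
Proof.
move=> Sc; rewrite compact_ultra => F FU FS.
have [M SM] := compact_tp_bounded S Sc.
have hE x : exists l : R, (fun a => tp_diff a x point) @ F --> l.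
  apply: ultra_cvg_bounded; apply: filterS FS => a; apply => b Sb.
  exact: SM.
(* Pointwise limit along [F] of the representatives that vanish at [point]. *)
pose h x := xget 0 [set l : R | (fun a => tp_diff a x point) @ F --> l].
have hP x : (fun a => tp_diff a x point) @ F --> h x.
  exact: (xgetPex 0 (hE x)).
have hdiff x y : (fun a => tp_diff a x y) @ F --> h x - h y.
  have -> : (fun a => tp_diff a x y) =
      (fun a => tp_diff a x point - tp_diff a y point).
    by apply/funext => a; rewrite /tp_diff; lra.
  exact: cvgB (hP x) (hP y).
(* Non-strict bounds pass to the limit, so [h] inherits domination, and with it continuity and
   boundedness. *)
have h_le x y K : (forall a, S a -> `|tp_diff a x y| <= K) -> `|h x - h y| <= K.
  move=> SK; apply: (closed_cvg (fun r : R => `|r| <= K) _ _ _ (hdiff x y)).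
    have -> : (fun r : R => is_true (`|r| <= K)) =
        Num.norm @^-1` [set z : R | z <= K] by [].
    apply: preimage_closed; first by move=> r _; exact: norm_continuous.
    exact: closed_le.
  by apply: filterS FS => a /(_ x y K SK).
have hBC : h \in @bc_pred X R.
  apply/bc_predP; split.
    move=> x; apply/cvgrPdist_le => e e0.
    by apply: filterS (compact_tp_near S x e Sc e0) => y; exact: h_le.
  exists (M + `|h point|); split; first exact: num_real.
  move=> K MK x _ /=; have /h_le := fun a => SM a x point.
  have := ler_normD (h x - h point) (h point); rewrite subrK; lra.
pose f : BC X R := MkBC hBC.
have fdiff x y : tp_diff (tp_class f) x y = h x - h y by rewrite tp_diff_class.
exists (tp_class f); split.
  by move=> x y K SK; rewrite fdiff; exact: h_le.
move=> U /nbhs_ballP[e /= e0 eU]; apply: filterS eU _.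
(* Five errors of [e / 6] will occur: from [x] to [p] and from [y] to [q], each for [a] and for [h],
   and one between [a] and [h] on the pair [p], [q]. The sixth share gives the strict inequality of
   the ball. *)
have e60 : 0 < e / 6 by rewrite divr_gt0.
have [A SA] := compact_tp_base_net S (e / 6) Sc e60.
(* Convergence is uniform on the finite net, as a filter is stable under finite intersections. *)
have FA : F (\bigcap_(p in [set` A]) \bigcap_(q in [set` A])
    [set a | `|tp_diff a p q - (h p - h q)| <= e / 6]).
  apply: filter_bigI => p _; apply: filter_bigI => q _.
  have /cvgrPdist_le /(_ _ e60) := hdiff p q.
  by apply: filterS => a; rewrite distrC.
apply: filterS2 FS FA => a Ca Aa; rewrite ballEmdist /=.
apply: (@le_lt_trans _ _ (5 * (e / 6))); last lra.
apply: mdist_le => x y; rewrite fdiff.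
have [p pA Sp] := SA x; have [q qA Sq] := SA y.
have := Ca _ _ _ Sp; have := Ca _ _ _ Sq.
have := h_le _ _ _ Sp; have := h_le _ _ _ Sq.
have := Aa p pA q qA; rewrite /= /tp_diff !ler_norml; lra.
Qed.

Lemma closed_osc_dominated S : compact S -> closed (osc_dominated S).
Proof.
move=> /compact_osc_dominated; apply: compact_closed.
exact: metric_hausdorff.
Qed.

End Oscillation.

(** * Compactness of the three hulls *)

Theorem theorem6p8 (R : realType) (X : ptopologicalType)
    (X_lc : locally_compact [set: X]) (X_T2 : hausdorff_space X)
    (mu : {measure set (g_sigma_algebraType (@open X)) -> \bar R})
    (mu_gt0 : (0 < mu [set: X])%E) (mu_lty : (mu [set: X] < +oo)%E)
    (mu_ae : forall f : BC X R,
      (exists c : R, {ae mu, forall x : X, f x = c}) ->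
      tp_class f = tp_class (bc_cst X 0))
    (S : set (TP X R)) (S_compact : compact S) :
  [/\ compact (lower_TCONV S), compact (upper_TCONV S) &
      compact (lower_upper_TCONV S)].
Proof.
have cC := compact_osc_dominated S S_compact.
have clC := closed_osc_dominated S S_compact.
have SC := osc_dominated_sub S.
have lC := lower_convex_osc_dominated S.
have uC := upper_convex_osc_dominated S.
have closed_smallest (P : set (TP X R) -> Prop) :
    closed (smallest [set C | closed C /\ P C] S).
  have -> : smallest [set C | closed C /\ P C] S =
      \bigcap_(C in [set C | (closed C /\ P C) /\ S `<=` C]) C by [].
  by apply: closed_bigI => C [[]].
split; apply: subclosed_compact cC _.
- exact: closed_smallest.
- exact: smallest_sub.
- exact: closed_smallest.
- exact: smallest_sub.
- exact: closed_closure.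
(* The hulls are absorbed from the inside out: upper convexity, then lower convexity, then
   closedness of [osc_dominated S]. *)
- rewrite /lower_upper_TCONV closureE; apply: smallest_sub => //.
  by apply: smallest_sub => //; exact: smallest_sub.
Qed.
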